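(* For every $\mu>0$, the minimization levels $\Lambda_D,\Lambda_N,\Lambda_{\tilde N},\Lambda_R$ defined in the context satisfy $$ \Lambda_{\tilde N} \leq \Lambda_N \leq \Lambda_R \leq \Lambda_D. $$
   Context: Let $s\in(0,1)$, let $\Omega\subset\mathbb{R}^n$ be a bounded open set with $C^{0,1}$ boundary, $\Omega^c=\mathbb{R}^n\setminus\Omega$, and let $\beta\in L^\infty(\mathbb{R}^n\setminus\Omega)$ be strictly positive. $G\colon[0,\infty)\to[0,\infty)$ is a Young function: $G(t)=\int_0^t g(\tau)\,d\tau$, with $g$ right continuous and nondecreasing, $g(0)=0$, $g(t)>0$ for $t>0$, $\lim_{t\to\infty}g(t)=\infty$, and $g=G'$. It satisfies: $1<p^-\leq \frac{tg(t)}{G(t)}\leq p^+<\infty$ for all $t>0$, for fixed constants $p^\pm$; $t\mapsto G(\sqrt t)$ is convex on $[0,\infty)$; $\int_0^1 \frac{G^{-1}(\tau)}{\tau^{(n+s)/n}}d\tau<\infty$ and $\int_1^\infty \frac{G^{-1}(\tau)}{\tau^{(n+s)/n}}d\tau=\infty$. Notation: $D_su(x,y)=\frac{u(x)-u(y)}{|x-y|^s}$, $d\mu=\frac{dx\,dy}{|x-y|^n}$ (unrelated to the number $\mu$). Modulars: $\Phi_{G,\Omega}(u)=\int_\Omega G(|u|)\,dx$, $\Phi_{s,G,\mathbb{R}^n}(u)=\iint_{\mathbb{R}^n\times\mathbb{R}^n}G(|D_su|)\,d\mu$, $\Phi_{s,G,\Omega}(u)=\iint_{\Omega\times\Omega}G(|D_su|)\,d\mu$,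 $\Phi_{s,G,*}(u)=\iint_{\mathbb{R}^{2n}\setminus(\Omega^c)^2}G(|D_su|)\,d\mu$, $\Phi_{G,\beta,\Omega^c}(u)=\int_{\mathbb{R}^n\setminus\Omega}\beta\,G(|u|)\,dx$. Spaces (of measurable functions): $W^{s,G}_0(\Omega)=\{u\colon\mathbb{R}^n\to\mathbb{R}: \int_{\mathbb{R}^n}G(|u|)\,dx<\infty,\ \Phi_{s,G,\mathbb{R}^n}(u)<\infty,\ u=0 \text{ a.e. in }\mathbb{R}^n\setminus\Omega\}$; $W^{s,G}_*(\Omega)=\{u\colon\mathbb{R}^n\to\mathbb{R}: \Phi_{G,\Omega}(u)<\infty,\ \Phi_{s,G,*}(u)<\infty\}$; $W^{s,G}_{reg}(\Omega)=\{u\colon\Omega\to\mathbb{R}: \Phi_{G,\Omega}(u)<\infty,\ \Phi_{s,G,\Omega}(u)<\infty\}$; $\mathcal{X}=\{u\in W^{s,G}_*(\Omega): \Phi_{G,\beta,\Omega^c}(u)<\infty\}$. For $\mu>0$: $\Lambda_D=\inf\left\{\frac{\Phi_{s,G,\mathbb{R}^n}(u)+\Phi_{G,\Omega}(u)}{\Phi_{G,\Omega}(u)}: u\in W^{s,G}_0(\Omega),\ \Phi_{G,\Omega}(u)=\mu\right\}$, $\Lambda_N=\inf\left\{\frac{\Phi_{s,G,*}(u)+\Phi_{G,\Omega}(u)}{\Phi_{G,\Omega}(u)}: u\in W^{s,G}_*(\Omega),\ \Phi_{G,\Omega}(u)=\mu\right\}$, $\Lambda_{\tilde N}=\inf\left\{\frac{\Phi_{s,G,\Omega}(u)+\Phi_{G,\Omega}(u)}{\Phi_{G,\Omega}(u)}: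 u\in W^{s,G}_{reg}(\Omega),\ \Phi_{G,\Omega}(u)=\mu\right\}$, $\Lambda_R=\inf\left\{\frac{\Phi_{s,G,*}(u)+\Phi_{G,\Omega}(u)+\Phi_{G,\beta,\Omega^c}(u)}{\Phi_{G,\Omega}(u)}: u\in\mathcal{X},\ \Phi_{G,\Omega}(u)=\mu\right\}$. *)

(* Defs.v *)
From HB Require Import structures.
From mathcomp Require Import all_boot all_order all_algebra.
From mathcomp Require Import all_classical all_reals all_analysis.
From mathcomp Require Import lra.
Import Order.TTheory GRing.Theory Num.Def Num.Theory.
Import numFieldNormedType.Exports.

Set Implicit Arguments.
Unset Strict Implicit.
Unset Printing Implicit Defensive.

Local Open Scope classical_set_scope.
Local Open Scope ring_scope.

(* Lebesgue measure on R^n is built from the outer measure given by countable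
   covers by half-open boxes, restricted to its Caratheodory-measurable sets. *)
Section lebesgue_outer_rV.
Context (R : realType) (n : nat).
Implicit Types (a b x : 'rV[R]_n) (A : set 'rV[R]_n).

Definition box a b : set 'rV[R]_n :=
  [set x | forall i, a ord0 i < x ord0 i <= b ord0 i].

Definition box_volume a b : R := \prod_i Num.max 0 (b ord0 i - a ord0 i).

(* The family is indexed by an arbitrary set D of naturals, so that it may be
   finite or empty. *)
Definition box_cover A (D : set nat) (F : nat -> 'rV[R]_n * 'rV[R]_n) :=
  A `<=` \bigcup_(k in D) box (F k).1 (F k).2.

Definition lebesgue_outer_rV A : \bar R :=
  ereal_inf [set (\esum_(k in c.1) (box_volume (c.2 k).1 (c.2 k).2)%:E)%E |
             c in [set c | box_cover A c.1 c.2]].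

Lemma box_volume_ge0 a b : 0 <= box_volume a b.
Proof. by apply: prodr_ge0 => i _; rewrite le_max lexx. Qed.

Lemma lebesgue_outer_rV_ge0 A : (0 <= lebesgue_outer_rV A)%E.
Proof.
apply: le_ereal_inf_tmp => _ [c _ <-]; apply: esum_ge0 => k _.
by rewrite lee_fin box_volume_ge0.
Qed.

Lemma lebesgue_outer_rV_le A D F : box_cover A D F ->
  (lebesgue_outer_rV A <=
   \esum_(k in D) (box_volume (F k).1 (F k).2)%:E)%E.
Proof. by move=> h; apply: ereal_inf_lbound; exists (D, F). Qed.

Lemma lebesgue_outer_rV0 : lebesgue_outer_rV set0 = 0%E.
Proof.
apply/eqP; rewrite eq_le lebesgue_outer_rV_ge0 andbT.
have h : box_cover set0 set0 (fun=> (0, 0)) by [].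
by apply: (le_trans (lebesgue_outer_rV_le h)); rewrite esum_set0.
Qed.

Lemma le_lebesgue_outer_rV :
  {homo lebesgue_outer_rV : A B / A `<=` B >-> (A <= B)%E}.
Proof.
move=> A B AB; apply: ereal_inf_le_tmp => _ [c cB <-]; exists c => //=.
exact: subset_trans cB.
Qed.

Lemma lebesgue_outer_rV_approx A (e : R) : 0 < e ->
  lebesgue_outer_rV A \is a fin_num ->
  exists c : set nat * (nat -> 'rV[R]_n * 'rV[R]_n), box_cover A c.1 c.2 /\
   (\esum_(k in c.1) (box_volume (c.2 k).1 (c.2 k).2)%:E <=
      lebesgue_outer_rV A + e%:E)%E.
Proof.
move=> e0 fA; have [_ [c cA <-] /ltW h] := lb_ereal_inf_adherent e0 fA.
by exists c.
Qed.

Lemma lebesgue_outer_rV_sigma_subadditive :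
  sigma_subadditive lebesgue_outer_rV.
Proof.
move=> A; have [[i ioo]|Afin] :=
    pselect (exists i, lebesgue_outer_rV (A i) = +oo%E).
  rewrite (eseries_pinfty _ _ ioo) ?leey// => k _.
  by rewrite -ltNye (lt_le_trans _ (lebesgue_outer_rV_ge0 _)).
have Af i : lebesgue_outer_rV (A i) \is a fin_num.
  rewrite ge0_fin_numE ?lebesgue_outer_rV_ge0// ltey.
  by apply/eqP => h; apply: Afin; exists i.
apply/lee_addgt0Pr => e e0.
have ek k : 0 < e / (2 ^ k.+1)%:R by rewrite divr_gt0// ltr0n expn_gt0.
have /choice[c cP] k := lebesgue_outer_rV_approx (ek k) (Af k).
pose V k j := (box_volume ((c k).2 j).1 ((c k).2 j).2)%:E.
have V0 k j : (0 <= V k j)%E by rewrite lee_fin box_volume_ge0.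
apply: (@le_trans _ _ (\sum_(k <oo) (lebesgue_outer_rV (A k)
                               + (e / (2 ^ k.+1)%:R)%:E))%E); last first.
  by apply: epsilon_trick => [k|]; [exact: lebesgue_outer_rV_ge0|exact: ltW].
apply: (@le_trans _ _ (\sum_(k <oo) \esum_(j in (c k).1) V k j)%E); last first.
  by apply: lee_nneseries => k *; [exact: esum_ge0|have [] := cP k].
rewrite nneseries_esumT; last by move=> k; exact: esum_ge0.
rewrite esum_esum//.
have /card_esym/ppcard_eqP[f] := card_nat2.
rewrite (@reindex_esum _ _ _ (f @^-1` ([set: nat] `*`` (fun k => (c k).1))) _ f);
    last first.
  split => //.
  - by move=> x y _ _ /(@inj _ _ _ f); rewrite !inE; apply.
  - move=> p Dp; exists (f^-1%FUN p); last by rewrite invK ?inE.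
    by rewrite /= invK ?inE.
apply: (@lebesgue_outer_rV_le _ _ (fun m => (c (f m).1).2 (f m).2)).
move=> x [k _ /((cP k).1)[j Dj xj]].
by exists (f^-1%FUN (k, j)); rewrite /= invK ?inE.
Qed.

HB.instance Definition _ := isOuterMeasure.Build R 'rV[R]_n lebesgue_outer_rV
  lebesgue_outer_rV0 lebesgue_outer_rV_ge0 le_lebesgue_outer_rV
  lebesgue_outer_rV_sigma_subadditive.

End lebesgue_outer_rV.

Fact rV_lebesgue_display : measure_display.
Proof. exact: default_measure_display. Qed.

Section lebesgue_rV_measurable.
Context (R : realType) (n : nat).

(* 'rV[R]_n is given the sigma-algebra of Lebesgue-measurable sets (not only of
   Borel sets). *)
HB.instance Definition _ := @isMeasurable.Build rV_lebesgue_display 'rV[R]_n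
  (@lebesgue_outer_rV R n).-caratheodory
  (caratheodory_measurable_set0 _)
  (@caratheodory_measurable_setC _ _ (@lebesgue_outer_rV R n))
  (@caratheodory_measurable_bigcup _ _ (@lebesgue_outer_rV R n)).

End lebesgue_rV_measurable.

Section lebesgue_rV.
Context (R : realType) (n : nat).
Implicit Types (a b x : 'rV[R]_n) (A : set 'rV[R]_n).

Let upd (i : 'I_n) x (t : R) : 'rV[R]_n :=
  \row_j (if j == i then t else x ord0 j).

Let box_volume_split a b i (c : R) :
  box_volume a (upd i b (Num.min (b ord0 i) c)) +
  box_volume (upd i a (Num.max (a ord0 i) c)) b = box_volume a b.
Proof.
rewrite /box_volume [X in X + _](bigD1 i)//= [X in _ + X](bigD1 i)//=.
rewrite [RHS](bigD1 i)//= !mxE eqxx.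
under eq_bigr => j /negPf ji do rewrite !mxE ji.
under [X in _ + _ * X]eq_bigr => j /negPf ji do rewrite !mxE ji.
rewrite -mulrDl; congr (_ * _).
move: (a ord0 i) (b ord0 i) => u v.
by case: (leP v c) => vc; case: (leP u c) => uc;
  do ?[case: (leP 0 _) => ?]; lra.
Qed.

Let halfspace_measurable (i : 'I_n) (c : R) :
  measurable [set x : 'rV[R]_n | x ord0 i <= c].
Proof.
apply: le_caratheodory_measurable => X; set H := [set x | _].
apply: le_ereal_inf_tmp => _ [[D F] /= XF <-].
pose F1 k := ((F k).1, upd i (F k).2 (Num.min ((F k).2 ord0 i) c)).
pose F2 k := (upd i (F k).1 (Num.max ((F k).1 ord0 i) c), (F k).2).
have c1 : box_cover (X `&` H) D F1.
  move=> x [/XF[k Dk xk] xH]; exists k => // j; rewrite /= mxE.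
  have /andP[u v] := xk j; case: eqP => [e|_]; last by rewrite u v.
  by move: u v; rewrite e => -> v; rewrite le_min v.
have c2 : box_cover (X `&` ~` H) D F2.
  move=> x [/XF[k Dk xk] /negP]; rewrite -ltNge => xH; exists k => // j.
  rewrite /= mxE.
  have /andP[u v] := xk j; case: eqP => [e|_]; last by rewrite u v.
  by move: u v; rewrite e => u ->; rewrite gt_max u xH.
apply: (le_trans (leeD (lebesgue_outer_rV_le c1) (lebesgue_outer_rV_le c2))).
rewrite -esumD; last 2 first.
- by move=> k _; rewrite lee_fin box_volume_ge0.
- by move=> k _; rewrite lee_fin box_volume_ge0.
by apply: le_esum => k _; rewrite -EFinD box_volume_split.
Qed.

Lemma measurable_box a b : measurable (box a b).
Proof.
pose H (i : 'I_n) c : set 'rV[R]_n := [set x | x ord0 i <= c].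
have -> : box a b = \bigcap_(i in [set: 'I_n])
    (H i (b ord0 i) `&` ~` H i (a ord0 i)).
  apply/seteqP; split => [x xab i _|x h i].
    by have /andP[ax xb] := xab i; split => //; apply/negP; rewrite -ltNge.
  by have [/= -> /negP] := h i Logic.I; rewrite -ltNge => ->.
apply: fin_bigcap_measurable => [|i _].
  exact: finite_finset.
apply: measurableI; first exact: halfspace_measurable.
by apply: measurableC; exact: halfspace_measurable.
Qed.

Definition lebesgue_rV : set 'rV[R]_n -> \bar R := @lebesgue_outer_rV R n.

HB.instance Definition _ := isMeasure.Build _ 'rV[R]_n R lebesgue_rV
  (caratheodory_measure0 (@lebesgue_outer_rV R n))
  (@caratheodory_measure_ge0 _ _ (@lebesgue_outer_rV R n))
  (@caratheodory_measure_sigma_additive _ _ (@lebesgue_outer_rV R n)).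

Let sigma_finite_lebesgue_rV : sigma_finite setT lebesgue_rV.
Proof.
exists (fun k => box (const_mx (- k%:R)) (const_mx k%:R)).
  apply/seteqP; split => // x _.
  have [k hk] : exists k : nat, \sum_i `|x ord0 i| < k%:R.
    by exists (truncn (\sum_i `|x ord0 i|)).+1; exact: truncnS_gt.
  exists k => // i; rewrite !mxE.
  have /ltr_normlP[] : `|x ord0 i| < k%:R.
    by apply: le_lt_trans hk; rewrite (bigD1 i)//= lerDl sumr_ge0.
  by move=> h1 h2; rewrite ltrNl h1 ltW.
move=> k; split; first exact: measurable_box.
set a := const_mx _; set b := const_mx _.
have h : box_cover (box a b) [set 0%N] (fun=> (a, b)) by move=> x ?; exists 0%N.
apply: (le_lt_trans (lebesgue_outer_rV_le h)).
by rewrite esum_set1 ?ltry// lee_fin box_volume_ge0.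
Qed.

HB.instance Definition _ :=
  @Measure_isSigmaFinite.Build _ _ _ lebesgue_rV sigma_finite_lebesgue_rV.

End lebesgue_rV.
Arguments lebesgue_rV R n : clear implicits.

(* The norm of 'rV[R]_n in the library is the sup norm. *)
Definition enorm (R : realType) (n : nat) (x : 'rV[R]_n) : R :=
  Num.sqrt (\sum_i x ord0 i ^+ 2).

(* Near each of its boundary points, up to an orthogonal change of coordinates,
   Omega is the set of points lying above the graph of a Lipschitz function of
   the n - 1 coordinates other than the k-th. *)
Definition lipschitz_boundary (R : realType) (n : nat) (Omega : set 'rV[R]_n) :=
  forall x0, (closure Omega `\` interior Omega) x0 ->
  exists (r : R) (Q : 'M[R]_n) (k : 'I_n) (gamma : 'rV[R]_n.-1 -> R) (L : R),
  [/\ 0 < r, Q *m Q^T = 1%:M,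
      forall a b, `|gamma a - gamma b| <= L * enorm (a - b) &
      forall x, enorm (x - x0) < r ->
        (Omega x <-> gamma (col' k (x *m Q)) < (x *m Q) ord0 k)].

(* Functions on [0, +oo[ are represented by functions on R whose values at
   negative reals are irrelevant. *)
Definition young_function (R : realType) (g G : R -> R) : Prop :=
  [/\ [/\ forall t, 0 <= t -> g x @[x --> t^'+] --> g t,
          {in `[0, +oo[ &, {homo g : t u / t <= u}},
          g 0 = 0,
          forall t, 0 < t -> 0 < g t &
          g t @[t --> +oo] --> +oo],
      forall t, 0 <= t ->
        (G t)%:E = (\int[lebesgue_measure]_(tau in `[0%R, t]) (g tau)%:E)%E &
      (* g = G': as g is only right continuous, G' is the right derivative *)
      forall t, 0 <= t -> h^-1 * (G (t + h) - G t) @[h --> 0^'+] --> g t].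

Definition growth_condition (R : realType) (g G : R -> R) (pm pp : R) : Prop :=
  1 < pm /\ forall t, 0 < t -> pm <= t * g t / G t <= pp.

Definition sqrt_convex (R : realType) (G : R -> R) : Prop :=
  @convex_function R R^o `[0, +oo[ (fun t => G (Num.sqrt t)).

Definition young_inverse (R : realType) (G : R -> R) : R -> R :=
  'pinv_(fun=> 0) `[0, +oo[ G.

Definition embedding_condition (R : realType) (n : nat) (s : R) (G : R -> R) :=
  let f tau := (young_inverse G tau / tau `^ ((n%:R + s) / n%:R))%:E in
  (\int[lebesgue_measure]_(tau in `]0%R, 1%R[) f tau < +oo)%E /\
  (\int[lebesgue_measure]_(tau in `]1%R, +oo[) f tau = +oo)%E.

Section modulars.
Context (R : realType) (n : nat) (s : R) (G : R -> R).
Implicit Types (Omega : set 'rV[R]_n) (beta u : 'rV[R]_n -> R).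

Definition Ds u (x y : 'rV[R]_n) : R := (u x - u y) / enorm (x - y) `^ s.

Definition Phi Omega u : \bar R :=
  (\int[lebesgue_rV R n]_(x in Omega) (G `|u x|)%:E)%E.

Definition Phi_beta beta Omega u : \bar R :=
  (\int[lebesgue_rV R n]_(x in ~` Omega) (beta x * G `|u x|)%:E)%E.

(* The integral of G(|D_s u|) over A against dx dy / |x - y|^n. *)
Definition Phi_s (A : set ('rV[R]_n * 'rV[R]_n)) u : \bar R :=
  (\int[lebesgue_rV R n \x lebesgue_rV R n]_(z in A)
     (G `|Ds u z.1 z.2| / enorm (z.1 - z.2) ^+ n)%:E)%E.

Definition Phi_s_full u := Phi_s setT u.
Definition Phi_s_reg Omega u := Phi_s (Omega `*` Omega) u.
Definition Phi_s_star Omega u := Phi_s (~` (~` Omega `*` ~` Omega)) u.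

Definition W0 Omega : set ('rV[R]_n -> R) :=
  [set u | [/\ measurable_fun [set: 'rV[R]_n] u,
    (Phi setT u < +oo)%E, (Phi_s_full u < +oo)%E &
    {ae lebesgue_rV R n, forall x, (~` Omega) x -> u x = 0}]].

Definition Wstar Omega : set ('rV[R]_n -> R) :=
  [set u | [/\ measurable_fun [set: 'rV[R]_n] u,
    (Phi Omega u < +oo)%E & (Phi_s_star Omega u < +oo)%E]].

(* A function on Omega is represented by a function on R^n whose values
   outside Omega are irrelevant. *)
Definition Wreg Omega : set ('rV[R]_n -> R) :=
  [set u | [/\ measurable_fun Omega u,
    (Phi Omega u < +oo)%E & (Phi_s_reg Omega u < +oo)%E]].

Definition Xspace beta Omega : set ('rV[R]_n -> R) :=
  [set u | Wstar Omega u /\ (Phi_beta beta Omega u < +oo)%E].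

Definition LambdaD Omega (mu : R) : \bar R :=
  ereal_inf [set ((Phi_s_full u + Phi Omega u) / Phi Omega u)%E |
             u in [set u | W0 Omega u /\ Phi Omega u = mu%:E]].

Definition LambdaN Omega (mu : R) : \bar R :=
  ereal_inf [set ((Phi_s_star Omega u + Phi Omega u) / Phi Omega u)%E |
             u in [set u | Wstar Omega u /\ Phi Omega u = mu%:E]].

Definition LambdaNreg Omega (mu : R) : \bar R :=
  ereal_inf [set ((Phi_s_reg Omega u + Phi Omega u) / Phi Omega u)%E |
             u in [set u | Wreg Omega u /\ Phi Omega u = mu%:E]].

Definition LambdaR beta Omega (mu : R) : \bar R :=
  ereal_inf [set ((Phi_s_star Omega u + Phi Omega u + Phi_beta beta Omega u)
                   / Phi Omega u)%E |
             u in [set u | Xspace beta Omega u /\ Phi Omega u = mu%:E]].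

End modulars.

(* Main.v *)
Require Import Defs.
From mathcomp Require Import all_boot all_order all_algebra.
From mathcomp Require Import all_classical all_reals all_analysis.
Import Order.TTheory GRing.Theory Num.Theory.
Import numFieldNormedType.Exports.

Local Open Scope classical_set_scope.
Local Open Scope ring_scope.

(** Each inequality compares infima by sending an admissible function of the
    right-hand problem to itself on the left: the class of competitors grows
    and the numerator of the quotient shrinks, the denominator being [mu].
    - From N to the regional problem, the interaction integral loses the region
      outside [Omega `*` Omega], where the integrand is nonnegative.
    - From R to N, one drops the boundary term, which is nonnegative since
      [beta] is positive almost everywhere outside [Omega].
    - From D to R, the interaction integral again shrinks, and the boundary term
      vanishes: a function that is null almost everywhere outside [Omega]
      makes the integrand zero there, because [G 0 = 0].

    The comparisons of integrals rest on the definition alone: the integral of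
    a nonnegative function is a supremum over the measurable simple functions
    below it, which is monotone by construction and insensitive to null sets,
    whether or not the function and its domain are measurable. This spares the
    study of the measurability of [G], of the singular kernel and of the
    regions of integration. *)

Section integral_without_measurability.
Local Open Scope ereal_scope.
Context d (T : measurableType d) (R : realType).
Variable mu : {measure set T -> \bar R}.
Implicit Types (A B D : set T) (f : T -> \bar R).
Import HBNNSimple.

(** A simple function below [f \_ A] is also below [f \_ B], so the supremum
    defining the second integral ranges over more functions. *)
Lemma ge0_subset_integral_nomeas A B f : A `<=` B ->
  (forall x, B x -> 0 <= f x) ->
  \int[mu]_(x in A) f x <= \int[mu]_(x in B) f x.
Proof.
move=> AB f0; rewrite ge0_integralE; last by move=> x /AB /f0.
rewrite ge0_integralE//; apply: ge_ereal_sup => _ [h /= hf <-].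
apply: ereal_sup_ubound; exists h => //= x.
apply: (le_trans (hf x)); rewrite !patchE; case: ifPn => [/set_mem Ax|_].
  by rewrite (mem_set (AB _ Ax)).
by case: ifPn => // /set_mem /f0.
Qed.

(** A nonnegative simple function below [f \_ D] takes each of its positive
    values on a null set only. *)
Lemma ge0_integral_ae0 D f : (forall x, D x -> 0 <= f x) ->
  {ae mu, forall x, D x -> f x = 0} -> \int[mu]_(x in D) f x = 0.
Proof.
move=> f0 [N [mN N0 fN]]; apply/eqP; rewrite eq_le integral_ge0// andbT.
rewrite ge0_integralE//; apply: ge_ereal_sup => _ [h /= hf <-].
rewrite sintegralEnnsfun fsbig1// => r /= r0.
suff -> : mu (h @^-1` [set r]) = 0 by rewrite mule0.
apply: (subset_measure0 _ mN _ N0) => // x /= hx; apply: fN => /= fx0.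
have := hf x; rewrite hx patchE; case: ifPn => [/set_mem /fx0 ->|_];
  by rewrite lee_fin leNgt r0.
Qed.

(** The negative part is zero almost everywhere, so it does not contribute. *)
Lemma integral_ae_ge0 D f : {ae mu, forall x, D x -> 0 <= f x} ->
  0 <= \int[mu]_(x in D) f x.
Proof.
move=> f0; rewrite integralE.
have -> : \int[mu]_(x in D) f^\- x = 0.
  apply: ge0_integral_ae0 => [x _|]; first exact: funeneg_ge0.
  apply: filterS f0 => x fx0 /fx0 ?.
  by rewrite funenegE; apply/max_idPr; rewrite oppe_le0.
by rewrite sube0; apply: integral_ge0 => x _; exact: funepos_ge0.
Qed.

Lemma integral_ae0 D f : {ae mu, forall x, D x -> f x = 0} ->
  \int[mu]_(x in D) f x = 0.
Proof.
move=> f0; rewrite integralE.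
have -> : \int[mu]_(x in D) f^\+ x = 0.
  apply: ge0_integral_ae0 => [x _|]; first exact: funepos_ge0.
  by apply: filterS f0 => x fx0 /fx0 fx; rewrite funeposE fx maxxx.
have -> : \int[mu]_(x in D) f^\- x = 0.
  apply: ge0_integral_ae0 => [x _|]; first exact: funeneg_ge0.
  by apply: filterS f0 => x fx0 /fx0 fx; rewrite funenegE fx oppe0 maxxx.
by rewrite sube0.
Qed.

End integral_without_measurability.

Lemma young_function_ge0 {R : realType} {g G : R -> R} :
  young_function g G -> forall t, 0 <= t -> 0 <= G t.
Proof.
move=> [[_ _ g0 gpos _] GE _] t t0; rewrite -lee_fin GE//.
apply: integral_ge0 => x /=; rewrite in_itv/= lee_fin => /andP[].
by rewrite le_eqVlt => /predU1P[<-|/gpos/ltW//]; rewrite g0.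
Qed.

Lemma young_function0 {R : realType} {g G : R -> R} :
  young_function g G -> G 0 = 0.
Proof.
move=> [_ GE _]; apply: EFin_inj; rewrite GE//.
by rewrite set_itv1 integral_set1.
Qed.

(** The common shape of the three comparisons, with [den] standing for
    [Phi G Omega]: fixing the denominator at [mu] leaves only the numerators
    to compare. *)
Lemma le_ereal_inf_quotient {R : realType} {T : Type} (K K' : set T)
    (num num' den : T -> \bar R) (mu : R) : 0 < mu ->
  (forall u, K' u -> K u /\ (num u <= num' u)%E) ->
  (ereal_inf [set (num u / den u)%E | u in [set u | K u /\ den u = mu%:E]] <=
   ereal_inf [set (num' u / den u)%E |
                u in [set u | K' u /\ den u = mu%:E]])%E.
Proof.
move=> mu0 le_num; apply: le_ereal_inf_tmp => _ [u [K'u den_u] <-].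
have [Ku le_u] := le_num u K'u.
apply: (@le_trans _ _ (num u / den u)%E).
  by apply: ereal_inf_lbound; exists u.
by rewrite den_u lee_wpmul2r// inver gt_eqF// lee_fin invr_ge0 ltW.
Qed.

Section levels.
Context {R : realType} {n : nat} {s : R} {g G : R -> R}.
Hypothesis G_young : young_function g G.
Implicit Types (Omega : set 'rV[R]_n) (beta u : 'rV[R]_n -> R).

Lemma le_Phi Omega Omega' u : Omega `<=` Omega' ->
  (Phi G Omega u <= Phi G Omega' u)%E.
Proof.
move=> sub; apply: ge0_subset_integral_nomeas => // x _.
by rewrite lee_fin (young_function_ge0 G_young).
Qed.

Lemma le_Phi_s (A B : set ('rV[R]_n * 'rV[R]_n)) u : A `<=` B ->
  (Phi_s s G A u <= Phi_s s G B u)%E.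
Proof.
move=> AB; apply: ge0_subset_integral_nomeas => // z _.
by rewrite lee_fin divr_ge0 ?exprn_ge0 ?sqrtr_ge0 ?(young_function_ge0 G_young).
Qed.

Lemma Phi_beta_ge0 beta Omega u :
  {ae lebesgue_rV R n, forall x, (~` Omega) x -> 0 < beta x} ->
  (0 <= Phi_beta G beta Omega u)%E.
Proof.
move=> beta_pos; apply: integral_ae_ge0; apply: filterS beta_pos => x bx /bx.
by move=> /ltW b0; rewrite lee_fin mulr_ge0 ?(young_function_ge0 G_young).
Qed.

Lemma Phi_beta_eq0 beta Omega u :
  {ae lebesgue_rV R n, forall x, (~` Omega) x -> u x = 0} ->
  Phi_beta G beta Omega u = 0%E.
Proof.
move=> u0; apply: integral_ae0; apply: filterS u0 => x ux /ux ->.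
by rewrite normr0 (young_function0 G_young) mulr0.
Qed.

Lemma LambdaNreg_le_LambdaN Omega (mu : R) : 0 < mu ->
  (LambdaNreg s G Omega mu <= LambdaN s G Omega mu)%E.
Proof.
move=> mu0; apply: le_ereal_inf_quotient => // u [u_meas Phi_fin star_fin].
have le_reg : (Phi_s_reg s G Omega u <= Phi_s_star s G Omega u)%E.
  by apply: le_Phi_s => z [Oz _] [].
split; last exact: leeD2r.
split=> //; first exact: measurable_funTS.
exact: le_lt_trans star_fin.
Qed.

Lemma LambdaN_le_LambdaR beta Omega (mu : R) : 0 < mu ->
  {ae lebesgue_rV R n, forall x, (~` Omega) x -> 0 < beta x} ->
  (LambdaN s G Omega mu <= LambdaR s G beta Omega mu)%E.
Proof.
move=> mu0 beta_pos; apply: le_ereal_inf_quotient => // u [star_u _].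
by split => //; rewrite leeDl// Phi_beta_ge0.
Qed.

Lemma LambdaR_le_LambdaD beta Omega (mu : R) : 0 < mu ->
  (LambdaR s G beta Omega mu <= LambdaD s G Omega mu)%E.
Proof.
move=> mu0; apply: le_ereal_inf_quotient => // u [u_meas Phi_fin full_fin u0].
have le_star : (Phi_s_star s G Omega u <= Phi_s_full s G u)%E.
  exact: le_Phi_s.
rewrite /Xspace /= Phi_beta_eq0// adde0; split; last exact: leeD2r.
split; last by rewrite ltry.
split=> //; last exact: le_lt_trans full_fin.
by apply: le_lt_trans Phi_fin; exact: le_Phi.
Qed.

End levels.

Theorem proposition5p6 (R : realType) (n : nat) (n_gt0 : (0 < n)%N)
    (s : R) (s01 : 0 < s < 1)
    (Omega : set 'rV[R]_n)
    (Omega_bounded : bounded_set Omega) (Omega_open : open Omega)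
    (Omega_lip : lipschitz_boundary Omega)
    (beta : 'rV[R]_n -> R)
    (beta_Loo : beta \_ (~` Omega) \in Lfun (lebesgue_rV R n) +oo%E)
    (beta_pos : {ae lebesgue_rV R n, forall x, (~` Omega) x -> 0 < beta x})
    (g G : R -> R) (pm pp : R)
    (G_young : young_function g G)
    (G_growth : growth_condition g G pm pp)
    (G_convex : sqrt_convex G)
    (G_embed : embedding_condition n s G)
    (mu : R) (mu_gt0 : 0 < mu) :
  [/\ (LambdaNreg s G Omega mu <= LambdaN s G Omega mu)%E,
      (LambdaN s G Omega mu <= LambdaR s G beta Omega mu)%E &
      (LambdaR s G beta Omega mu <= LambdaD s G Omega mu)%E].
Proof.
split.
- exact: (LambdaNreg_le_LambdaN G_young).
- exact: (LambdaN_le_LambdaR G_young).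
- exact: (LambdaR_le_LambdaD G_young).
Qed.
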